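(* Let $H=(Q,E,D,F,G,R)$ be a cyclic hybrid system with polynomial data $g_{q,k}$ ($1\le k\le K_q$), $f_q$, $h_{e,0}$, $h_{e,l}$ ($1\le l\le N_q$, $q=s(e)$), $\phi_e$, and let $z=\{z_q\}_{q\in Q}$ be a Zeno equilibrium of $H$. For each $q\in Q$ let $w_{qk}\in\mathbb{R}[x]$, $k=1,\dots,K_{qw}$, be polynomials such that $$W_q:=\{x\in D_q : w_{qk}(x)\ge 0,\ k=1,\dots,K_{qw}\}$$ is a neighborhood of $z_q$ in $D_q$. Suppose there exist (i) $a_{qk},c_{qk},i_{qk}\in\Sigma_x$ for $k=1,\dots,K_{qw}$, $q\in Q$; (ii) $b_{qk},d_{qk},j_{qk}\in\Sigma_x$ for $k=1,\dots,K_q$, $q\in Q$; (iii) $m_{e,l}\in\Sigma_x$ for $e\in E$ and $l=1,\dots,N_q$ (with $q=s(e)$); (iv) $V_q\in\mathbb{R}[x]$ for $q\in Q$ and $m_{e,0}\in\mathbb{R}[x]$ for $e\in E$; (v) constants $\alpha,\gamma>0$ and $r_q\in(0,1]$ for $q\in Q$, with $r_q<1$ for some $q\in Q$; such that $$V_q-\alpha x^Tx-\sum_{k=1}^{K_{qw}}a_{qk}w_{qk}-\sum_{k=1}^{K_q}b_{qk}g_{q,k}\in\Sigma_x\quad\text{for all }q\in Q,$$ $$V_q(z_q)=0\quad\text{for all }q\in Q,$$ $$-\nabla V_q^Tf_q-\gamma-\sum_{k=1}^{K_{qw}}c_{qk}w_{qk}-\sum_{k=1}^{K_q}d_{qk}g_{q,k}\in\Sigma_x\quad\text{for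 all }q\in Q,$$ $$r_qV_q-V_{q'}(\phi_e)-m_{e,0}h_{e,0}-\sum_{l=1}^{N_q}m_{e,l}h_{e,l}-\sum_{k=1}^{K_{qw}}i_{qk}w_{qk}-\sum_{k=1}^{K_q}j_{qk}g_{q,k}\in\Sigma_x\quad\text{for all }e=(q,q')\in E.$$ Then $z$ is Zeno stable.
   Context: $\mathbb{R}[x]$ is the ring of real polynomials in $x=(x_1,\dots,x_n)$; $\Sigma_x\subset\mathbb{R}[x]$ is the set of sums of squares of polynomials (finite sums $\sum_i f_i^2$ with $f_i\in\mathbb{R}[x]$). $V_{q'}(\phi_e)$ denotes the composition $x\mapsto V_{q'}(\phi_e(x))$. Hybrid system: a tuple $H=(Q,E,D,F,G,R)$ where $Q$ is a finite set of discrete modes; $E\subset Q\times Q$ is a set of edges; $D=\{D_q\}_{q\in Q}$ with domains $D_q\subseteq\mathbb{R}^n$; $F=\{f_q\}_{q\in Q}$ with vector fields $f_q:D_q\to\mathbb{R}^n$; $G=\{G_e\}_{e\in E}$ with guard sets $G_e\subset D_q$ for $e=(q,q')$; $R=\{\phi_e\}_{e\in E}$ with reset maps $\phi_e:G_e\to D_{q'}$ for $e=(q,q')$. For $e=(q,q')$ write $s(e)=q$, $t(e)=q'$. Standing assumption (polynomial data): each $f_q$ and each $\phi_e$ is a vector of polynomials in $\mathbb{R}[x]$, and there are polynomials with $D_q=\{x\in\mathbb{R}^n: g_{q,i}(x)\ge 0,\ i=1,\dots,K_q\}$ and, for $e$ with $s(e)=q$, $G_e=\{x\in\mathbb{R}^n: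 h_{e,0}(x)=0,\ h_{e,k}(x)\ge 0,\ k=1,\dots,N_q\}$. Cyclic: for each $q\in Q$ there are a unique edge $e_q\in E$ with $s(e_q)=q$ and a unique edge $e_q'\in E$ with $t(e_q')=q$, and the modes and edges form a connected digraph. Execution with initial condition $(q_0,x_0)$: a tuple $\chi=(I,T,p,C)$ where $I\subseteq\mathbb{N}$ indexes intervals (starting at $1$); $T=\{T_i\}_{i\in I}$ are consecutive open time intervals $T_i=(\tau_i,\tau_{i+1})\subset\mathbb{R}_+$; $p:I\to Q$; $C=\{c_i\}_{i\in I}$ are continuously differentiable functions on $T_i$ (values at endpoints being understood as limits), such that: $c_1(0)=x_0$, $p(1)=q_0$ (with $\tau_1=0$); $\dot c_i(t)=f_{p(i)}(c_i(t))$ and $c_i(t)\in D_{p(i)}$ for $t\in T_i$, $i\in I$; $c_i(\tau_{i+1})\in G_{(p(i),p(i+1))}$; and $c_{i+1}(\tau_{i+1})=\phi_{(p(i),p(i+1))}(c_i(\tau_{i+1}))$ (the last two whenever the transition from interval $i$ to $i+1$ occurs). The execution is Zeno if $I=\mathbb{N}$ and $\lim_{i\to\infty}\tau_i<\infty$. Zeno equilibrium: a set $z=\{z_q\}_{q\in Q}$ with $z_q\in D_q$ such that for each $e=(q,q')\in E$, $z_q\in G_e$ and $\phi_e(z_q)=z_{q'}$, and $f_q(z_q)\ne 0$ for all $q\in Q$. Zeno stability: a Zeno equilibrium $z$ is Zeno stable if for each $q\in Q$ there is a neighborhood $Z_q$ of $z_q$ (in $D_q$) such that for any initial condition $(q_0,x_0)$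 with $x_0\in Z_{q_0}$, the execution $\chi=(I,T,p,C)$ with that initial condition is Zeno, and for any $\epsilon>0$ there is $N\in\mathbb{N}$ such that $i>N$ implies $\|c_i(\tau_{i+1})-z_{p(i)}\|\le\epsilon$.
   Formalization: Zeno stability is claimed only for executions that do not stop at a finite time in a state; existence of a Zeno execution from each initial condition is not asserted, since an execution may be blocked outside the guard. Intervals of zero length are also allowed. *)

(* Defs.v *)
(* MathComp / MathComp-Analysis; polynomials from multinomials. *)
From mathcomp Require Import all_boot all_order all_algebra.
From mathcomp Require Import all_classical all_reals all_analysis.
From mathcomp.multinomials Require mpoly.
(* The notations of mpoly clash with those of MathComp-Analysis: only its
   structure instances are imported, and its constants are qualified. *)
Import (canonicals) mpoly.
Import Order.TTheory GRing.Theory Num.Theory.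
Import numFieldNormedType.Exports.

Set Implicit Arguments.
Unset Strict Implicit.
Unset Printing Implicit Defensive.

Local Open Scope classical_set_scope.
Local Open Scope ring_scope.

Section Polynomials.
Variables (R : realType) (n : nat).
Local Notation poly := (mpoly.mpoly n R).

Definition sos (p : poly) : Prop := exists s : seq poly, p = \sum_(f <- s) f ^+ 2.

Definition peval (p : poly) (x : 'rV[R]_n) : R := mpoly.meval (fun i => x 0 i) p.

Definition pevalv (f : n.-tuple poly) (x : 'rV[R]_n) : 'rV[R]_n :=
  \row_i peval (tnth f i) x.

(* The polynomial x^T x. *)
Definition sqnorm_poly : poly := \sum_(i < n) mpoly.mpolyX R (mpoly.mnm1 i) ^+ 2.

(* The Lie derivative (grad V)^T f. *)
Definition lie_poly (V : poly) (f : n.-tuple poly) : poly :=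
  \sum_(i < n) mpoly.mderiv i V * tnth f i.

(* The norm provided by the library on 'rV[R]_n is the sup norm. *)
Definition enorm (x : 'rV[R]_n) : R := Num.sqrt (\sum_(i < n) x 0 i ^+ 2).

End Polynomials.

(* Vector fields, guards and resets are total functions; the values of
   [vfield q] outside [dom q], of [reset e] outside [guard e], and of [guard]
   and [reset] on pairs that are not edges, are irrelevant. *)
Record hybrid_system (R : realType) (n : nat) (Q : finType) := HybridSystem {
  edges : {set Q * Q};
  dom : Q -> set 'rV[R]_n;
  vfield : Q -> 'rV[R]_n -> 'rV[R]_n;
  guard : Q * Q -> set 'rV[R]_n;
  reset : Q * Q -> 'rV[R]_n -> 'rV[R]_n;
  guard_dom : forall e, e \in edges -> guard e `<=` dom e.1;
  reset_dom : forall e, e \in edges ->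
    forall x, guard e x -> dom e.2 (reset e x)
}.

Record poly_data (R : realType) (n : nat) (Q : finType) := PolyData {
  numg : Q -> nat;
  gpoly : forall (q : Q) (k : 'I_(numg q)), mpoly.mpoly n R;
  fpoly : Q -> n.-tuple (mpoly.mpoly n R);
  numh : Q -> nat;
  h0poly : Q * Q -> mpoly.mpoly n R;
  hpoly : forall (e : Q * Q) (l : 'I_(numh e.1)), mpoly.mpoly n R;
  phipoly : Q * Q -> n.-tuple (mpoly.mpoly n R)
}.

Arguments gpoly {R n Q} p q k.
Arguments hpoly {R n Q} p e l.

Section HybridSystems.
Variables (R : realType) (n : nat) (Q : finType).
Implicit Types (H : hybrid_system R n Q) (P : poly_data R n Q).

Record has_poly_data H P : Prop := HasPolyData {
  dom_poly : forall q, dom H q = [set x | forall k, 0 <= peval (gpoly P q k) x];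
  vfield_poly : forall q x, dom H q x -> vfield H q x = pevalv (fpoly P q) x;
  guard_poly : forall e, e \in edges H ->
    guard H e = [set x | peval (h0poly P e) x = 0 /\
                         forall l, 0 <= peval (hpoly P e l) x];
  reset_poly : forall e, e \in edges H ->
    forall x, guard H e x -> reset H e x = pevalv (phipoly P e) x
}.

(* Connectedness is that of the underlying undirected graph; given the two
   uniqueness conditions it is equivalent to strong connectedness. *)
Definition cyclic_system H : Prop :=
  [/\ forall q, exists! e, e \in edges H /\ e.1 = q,
      forall q, exists! e, e \in edges H /\ e.2 = q
    & forall q q', connect [rel u v | ((u, v) \in edges H)
                                   || ((v, u) \in edges H)] q q'].

Definition zeno_equilibrium H (z : Q -> 'rV[R]_n) : Prop :=
  [/\ forall q, dom H q (z q),
      forall e, e \in edges H ->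
        guard H e (z e.1) /\ reset H e (z e.1) = z e.2
    & forall q, vfield H q (z q) != 0].

(* The i-th interval (i >= 1) is ]tau i, tau i.+1[; the right end of the last
   interval, if any, may be +oo.  Values at indices outside [idx], other than
   that right end, are irrelevant. *)
Record execution := Execution {
  idx : set nat;
  tau : nat -> \bar R;
  mode : nat -> Q;
  traj : nat -> R -> 'rV[R]_n
}.
Implicit Types chi : execution.

(* Degenerate intervals tau i = tau i.+1 (several transitions at the same time)
   are allowed: the point [z q] of a Zeno equilibrium may only be able to jump.
   On such an interval [traj chi i] is just the point
   [traj chi i (fine (tau chi i))]. *)
Record is_execution H (q0 : Q) (x0 : 'rV[R]_n) chi : Prop := IsExecution {
  exec_idx0 : ~ idx chi 0%N;
  exec_idx1 : idx chi 1%N;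
  exec_idxS : forall i, (0 < i)%N -> idx chi i.+1 -> idx chi i;
  exec_tau1 : tau chi 1%N = 0%E;
  exec_tau_fin : forall i, idx chi i -> tau chi i \is a fin_num;
  exec_tau_le : forall i, idx chi i -> (tau chi i <= tau chi i.+1)%E;
  exec_mode1 : mode chi 1%N = q0;
  exec_init : traj chi 1%N 0 = x0;
  exec_flow : forall i t, idx chi i -> (tau chi i < t%:E < tau chi i.+1)%E ->
    [/\ is_derive t 1 (traj chi i) (vfield H (mode chi i) (traj chi i t)),
        {for t, continuous (derive1 (traj chi i))}
      & dom H (mode chi i) (traj chi i t)];
  exec_left : forall i, idx chi i -> (tau chi i < tau chi i.+1)%E ->
    traj chi i t @[t --> (fine (tau chi i))^'+] -->
    traj chi i (fine (tau chi i));
  exec_right : forall i, idx chi i -> idx chi i.+1 ->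
    (tau chi i < tau chi i.+1)%E ->
    traj chi i t @[t --> (fine (tau chi i.+1))^'-] -->
    traj chi i (fine (tau chi i.+1));
  exec_jump : forall i, idx chi i -> idx chi i.+1 ->
    let e := (mode chi i, mode chi i.+1) in
    let x := traj chi i (fine (tau chi i.+1)) in
    [/\ e \in edges H, guard H e x
      & traj chi i.+1 (fine (tau chi i.+1)) = reset H e x]
}.

Definition zeno chi : Prop :=
  idx chi = [set i | (0 < i)%N] /\
  exists l : R, tau chi i @[i --> \oo] --> l%:E.

(* [chi] stops at a finite time in a state of R^n.  Such an execution either is
   a proper prefix of a longer one, or is blocked: it has reached a state from
   which the system can neither flow nor jump. *)
Definition terminates chi : Prop :=
  exists i, [/\ idx chi i, ~ idx chi i.+1, tau chi i.+1 \is a fin_num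
    & (tau chi i < tau chi i.+1)%E ->
      exists x : 'rV[R]_n,
        traj chi i t @[t --> (fine (tau chi i.+1))^'-] --> x].

(* Every finite prefix of an execution is an execution, hence the restriction
   to executions that do not terminate.  Executions need not be unique, and all
   the non-terminating ones are considered. *)
Definition zeno_stable H (z : Q -> 'rV[R]_n) : Prop :=
  exists Z : Q -> set 'rV[R]_n,
    (forall q, Z q `<=` dom H q /\ within (dom H q) (nbhs (z q)) (Z q)) /\
    forall q0 x0 chi, Z q0 x0 -> is_execution H q0 x0 chi ->
      ~ terminates chi ->
      zeno chi /\
      forall eps : R, 0 < eps -> exists N : nat, forall i, (N < i)%N ->
        enorm (traj chi i (fine (tau chi i.+1)) - z (mode chi i)) <= eps.

End HybridSystems.

(* Main.v *)
Require Import Defs.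
From mathcomp Require Import all_boot all_order all_algebra.
From mathcomp Require Import all_classical all_reals all_analysis.
From mathcomp.multinomials Require mpoly.
From mathcomp Require Import ring lra.
Import (canonicals) mpoly.
Import Order.TTheory GRing.Theory Num.Theory.
Import numFieldNormedType.Exports.

Local Open Scope classical_set_scope.
Local Open Scope ring_scope.

(** V_q >= alpha |x|^2 on W_q together with V_q(z_q) = 0 forces z_q = 0, so all
    the estimates take place near the origin.  Choose delta such that the points
    of D_q with |x|^2 <= delta lie in W_q, and rho <= delta such that every reset
    maps |x|^2 <= rho into |x|^2 <= delta.  Then the set of the x in D_q with
    |x|^2 < rho and V_q(x) < alpha rho cannot be left: along a flow V_q decreases
    at rate gamma, hence |x|^2 <= V_q / alpha never reaches rho, and a reset lands
    in W_q', where |x|^2 is again controlled by V_q'.  Since V_q >= 0, the total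
    flow time is at most V_{q0}(x0) / gamma.  The system being cyclic, any #|Q|
    consecutive jumps contract V by some r_q < 1, hence V tends to 0 and so does
    the state. *)

(** * Polynomial evaluation: algebra, continuity, derivatives, local bounds *)

(** Every monomial is a product of variables, so a property stable under sums and products need only
    be checked on constants and variables. Continuity, the chain rule and boundedness on balls all
    follow this pattern. *)
Lemma mpoly_ring_ind (R : realType) (n : nat)
    (K : mpoly.mpoly n R -> Prop) :
  (forall c, K (mpoly.mpolyC n c)) ->
  (forall i, K (mpoly.mpolyX R (mpoly.mnm1 i))) ->
  (forall p q, K p -> K q -> K (p + q)) ->
  (forall p q, K p -> K q -> K (p * q)) ->
  forall p, K p.
Proof.
move=> KC KX KD KM.
have K1 : K 1 by rewrite -mpoly.mpolyC1; exact: KC.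
elim/mpoly.mpolyind => [|c m p _ _ Kp]; first by rewrite -mpoly.mpolyC0; exact: KC.
apply: KD => //; rewrite -mpoly.mul_mpolyC; apply: (KM) => //.
rewrite mpoly.mpolyXE_id; apply: (big_ind K) => [|u v|i _]; [by []|exact: KM|].
by elim: (X in _ ^+ X) => [|k IH]; rewrite ?expr0 ?exprS//; exact: KM.
Qed.

Section Polynomials.
Context {R : realType} {n : nat}.
Implicit Types (p q : mpoly.mpoly n R) (x : 'rV[R]_n).

Lemma pevalC c x : peval (mpoly.mpolyC n c) x = c.
Proof. exact: mpoly.mevalC. Qed.

Lemma pevalX i x : peval (mpoly.mpolyX R (mpoly.mnm1 i)) x = x 0 i.
Proof. exact: mpoly.mevalXU. Qed.

Lemma pevalD p q x : peval (p + q) x = peval p x + peval q x.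
Proof. exact: mpoly.mevalD. Qed.

Lemma pevalN p x : peval (- p) x = - peval p x.
Proof. exact: mpoly.mevalN. Qed.

Lemma pevalB p q x : peval (p - q) x = peval p x - peval q x.
Proof. exact: mpoly.mevalB. Qed.

Lemma pevalM p q x : peval (p * q) x = peval p x * peval q x.
Proof. exact: mpoly.mevalM. Qed.

Lemma pevalZ c p x : peval (c *: p) x = c * peval p x.
Proof. exact: mpoly.mevalZ. Qed.

Lemma peval_sum (I : Type) (s : seq I) (F : I -> mpoly.mpoly n R) x :
  peval (\sum_(i <- s) F i) x = \sum_(i <- s) peval (F i) x.
Proof.
elim/big_rec2: _ => [|i u v _ <-]; last by rewrite pevalD.
by rewrite -mpoly.mpolyC0 pevalC.
Qed.

Lemma peval_comp (phi : n.-tuple (mpoly.mpoly n R)) p x :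
  peval (mpoly.comp_mpoly phi p) x = peval p (pevalv phi x).
Proof.
rewrite /peval mpoly.comp_mpoly_meval; apply: mpoly.meval_eq => i.
by rewrite mxE.
Qed.

Lemma sos_ge0 p x : sos p -> 0 <= peval p x.
Proof.
move=> [s ->]; rewrite peval_sum; apply: sumr_ge0 => f _.
by rewrite expr2 pevalM -expr2 sqr_ge0.
Qed.

Lemma sos_comb_ge0 (I : finType) (s g : I -> mpoly.mpoly n R) x :
  (forall i, sos (s i)) -> (forall i, 0 <= peval (g i) x) ->
  0 <= peval (\sum_i s i * g i) x.
Proof.
move=> ss g0; rewrite peval_sum; apply: sumr_ge0 => i _.
by rewrite pevalM mulr_ge0// sos_ge0.
Qed.

Lemma continuous_peval p : continuous (peval p).
Proof.
move=> x; elim/mpoly_ring_ind: p => [c|i|p q IHp IHq|p q IHp IHq].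
- rewrite (_ : peval _ = cst c); first exact: cst_continuous.
  by apply/funext => y; rewrite pevalC.
- rewrite (_ : peval _ = fun M : 'rV[R]_n => M 0 i); first exact: coord_continuous.
  by apply/funext => y; rewrite pevalX.
- rewrite (_ : peval _ = peval p \+ peval q); first exact: continuousD.
  by apply/funext => y; rewrite pevalD.
- rewrite (_ : peval _ = peval p \* peval q); first exact: continuousM.
  by apply/funext => y; rewrite pevalM.
Qed.

Lemma cvg_peval (T : Type) (F : set_system T) (FF : Filter F)
    (u : T -> 'rV[R]_n) l p :
  u t @[t --> F] --> l -> peval p (u t) @[t --> F] --> peval p l.
Proof. by move=> ul; apply: (cvg_comp _ _ ul); exact: continuous_peval. Qed.

(** Chain rule by ring induction: variables reduce to the derivatives of the coordinates of [u], and
    products to the Leibniz rule for both [mderiv] and [is_derive]. *)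
Lemma is_derive_peval (u : R -> 'rV[R]_n) (t : R) v p :
  is_derive t 1 u v ->
  is_derive t 1 (peval p \o u)
    (\sum_(i < n) peval (mpoly.mderiv i p) (u t) * v 0 i).
Proof.
move=> [du Du].
have dui i : is_derive t 1 (fun s => u s 0 i) (v 0 i).
  split; first exact: (derivable_mxP u t 1).1.
  by rewrite -Du derive_mx// mxE.
elim/mpoly_ring_ind: p => [c|j|p q IHp IHq|p q IHp IHq].
- rewrite (_ : peval _ \o u = cst c); last by apply/funext => s /=; rewrite pevalC.
  apply: is_derive_eq; rewrite big1// => i _.
  by rewrite mpoly.mderivC -mpoly.mpolyC0 pevalC mul0r.
- rewrite (_ : peval _ \o u = fun s => u s 0 j); last first.
    by apply/funext => s /=; rewrite pevalX.
  apply: is_derive_eq; rewrite (bigD1 j)//= big1 ?addr0.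
    rewrite mpoly.mderivX mpoly.mnm1E eqxx /= scale1r.
    (* The exponent left by [mderivX] is [mnm1 j] minus itself; writing the first as [0 + mnm1 j]
       lets it cancel to the trivial monomial. *)
    rewrite -{1}[mpoly.mnm1 j]mpoly.add0m mpoly.addmK mpoly.mpolyX0.
    by rewrite -mpoly.mpolyC1 pevalC mul1r.
  move=> i ij; rewrite mpoly.mderivX mpoly.mnm1E eq_sym (negPf ij) scale0r.
  by rewrite -mpoly.mpolyC0 pevalC mul0r.
- rewrite (_ : peval _ \o u = (peval p \o u) \+ (peval q \o u)); last first.
    by apply/funext => s /=; rewrite pevalD.
  apply: is_derive_eq; rewrite -big_split; apply: eq_bigr => i _ /=.
  by rewrite mpoly.mderivD pevalD mulrDl.
- rewrite (_ : peval _ \o u = (peval p \o u) \* (peval q \o u)); last first.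
    by apply/funext => s /=; rewrite pevalM.
  apply: is_derive_eq; rewrite !scaler_sumr -big_split; apply: eq_bigr => i _ /=.
  rewrite mpoly.mderivM pevalD !pevalM /GRing.scale /=; ring.
Qed.

Lemma peval_lie (V : mpoly.mpoly n R) (f : n.-tuple (mpoly.mpoly n R)) x :
  peval (lie_poly V f) x =
  \sum_(i < n) peval (mpoly.mderiv i V) x * pevalv f x 0 i.
Proof. by rewrite peval_sum; apply: eq_bigr => i _; rewrite pevalM mxE. Qed.

Definition sqnorm x : R := peval (sqnorm_poly R n) x.

Lemma sqnormE x : sqnorm x = \sum_(i < n) x 0 i ^+ 2.
Proof.
rewrite /sqnorm peval_sum; apply: eq_bigr => i _.
by rewrite expr2 pevalM pevalX expr2.
Qed.

Lemma sqnorm_ge0 x : 0 <= sqnorm x.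
Proof. by rewrite sqnormE sumr_ge0// => i _; exact: sqr_ge0. Qed.

Lemma coord_sqnorm x i : x 0 i ^+ 2 <= sqnorm x.
Proof.
by rewrite sqnormE (bigD1 i)//= lerDl sumr_ge0// => k _; exact: sqr_ge0.
Qed.

Lemma sqnorm_le0 x : sqnorm x <= 0 -> x = 0.
Proof.
move=> x0; apply/rowP => i; rewrite mxE; apply/eqP; rewrite -sqrf_eq0.
by rewrite eq_le sqr_ge0 andbT (le_trans (coord_sqnorm x i)).
Qed.

Lemma sqnorm0 : sqnorm 0 = 0.
Proof. by rewrite sqnormE big1// => i _; rewrite mxE expr0n. Qed.

(** The topology on row vectors comes from the sup norm, while the certificates speak of [x^T x].
    The two are compared through the bound of each squared coordinate by [sqnorm x]. *)
Lemma nbhs0_sqnorm (U : set 'rV[R]_n) :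
  nbhs (0 : 'rV[R]_n) U ->
  exists2 e : R, 0 < e & forall x, sqnorm x <= e -> U x.
Proof.
(* Halving [e] turns the large inequality on [sqnorm] into the strict one of the open ball. *)
move=> /nbhs_ballP[e /= e0 eU]; exists ((e / 2) ^+ 2).
  by rewrite exprn_gt0// divr_gt0.
move=> x xe; apply: eU; rewrite -ball_normE /= sub0r normrN.
apply: (@le_lt_trans _ _ (e / 2)); last by rewrite ltr_pdivrMr// ltr_pMr// ltr1n.
rewrite [leLHS]/Num.Def.normr/= mx_normrE bigmax_le ?divr_ge0 ?(ltW e0)//= => -[k i] _.
rewrite -ler_sqr ?nnegrE ?divr_ge0 ?(ltW e0)//= (ord1 k) real_normK ?num_real//.
exact: le_trans (coord_sqnorm x i) xe.
Qed.

Lemma bounded_peval p (rho : R) :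
  exists M : R, forall x, sqnorm x <= rho -> `|peval p x| <= M.
Proof.
elim/mpoly_ring_ind: p => [c|i|p q [M pM] [N qN]|p q [M pM] [N qN]].
- by exists `|c| => x _; rewrite pevalC.
(* From [(|x_i| - 1)^2 >= 0] comes [2 |x_i| <= 1 + x_i^2 <= 1 + rho], which avoids a square root. *)
- exists (1 + rho) => x xr; rewrite pevalX.
  have := le_trans (coord_sqnorm x i) xr.
  have := sqr_ge0 (`|x 0 i| - 1); rewrite -(real_normK (num_real (x 0 i))).
  have := normr_ge0 (x 0 i); nra.
- exists (M + N) => x xr; rewrite pevalD (le_trans (ler_normD _ _))//.
  by rewrite lerD ?pM ?qN.
- exists (M * N) => x xr; rewrite pevalM normrM.
  by rewrite ler_pM ?pM ?qN.
Qed.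

End Polynomials.

(** * Lyapunov estimates along a single flow *)

Section Flow.
Context {R : realType} {n : nat}.
Implicit Types (V p : mpoly.mpoly n R) (f : n.-tuple (mpoly.mpoly n R)).
Implicit Types (x : 'rV[R]_n) (u : R -> 'rV[R]_n).

(** [T] is the infimum of the times at which [g] is at least [rho]; continuity makes it one of these
    times. *)
Lemma first_exit (g : R -> R) (a b rho : R) :
  {within `[a, b], continuous g} -> g a < rho -> a <= b -> rho <= g b ->
  exists T, [/\ a < T, T <= b, rho <= g T & forall t, a <= t < T -> g t < rho].
Proof.
move=> cg ga ab gb.
pose B := [set t | a <= t <= b /\ rho <= g t].
have Bb : B b by rewrite /B /= ab lexx.
have lbB : lbound B a by move=> t [/andP[]].
have hB : has_inf B by split; [exists b | exists a].
have infB t : B t -> inf B <= t by move=> Bt; apply: ge_inf => //; exact: hB.2.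
have aT : a <= inf B by apply: lb_le_inf => //; exists b.
have Tb : inf B <= b := infB _ Bb.
have gT : rho <= g (inf B).
  rewrite leNgt; apply/negP => gT.
  have /subspace_continuousP/(_ (inf B)) := cg.
  rewrite /= in_itv/= aT Tb => /(_ isT) cT.
  have : within `[a, b] (nbhs (inf B)) [set y | g y < rho].
    exact: (cT [set y | y < rho] (lt_nbhsl gT)).
  (* If [g] were below [rho] at the infimum, it would be so on a whole ball around it, yet that ball
     contains a point of [B]. *)
  move=> /nbhs_ballP[e /= e0 eg].
  have [y By yT] := inf_adherent e0 hB.
  have [/andP[ay yb] gy] := By.
  suff : g y < rho by rewrite ltNge gy.
  apply: (eg y); last by rewrite /= in_itv/= ay.
  by rewrite -ball_normE /= distrC ger0_norm ?subr_ge0 ?infB// ltrBlDl.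
exists (inf B); split => // [|t /andP[at_ tT]].
  by rewrite lt_neqAle aT andbT; apply/eqP => E; move: gT; rewrite -E leNgt ga.
rewrite ltNge; apply/negP => gt; have := tT; rewrite ltNge infB//.
by split => //; rewrite at_ (le_trans (ltW tT)).
Qed.

(** Mean value theorem for [V] along [u], whose derivative is the Lie derivative; the case [a = b]
    is separate because the theorem is applied with [a < b]. *)
Lemma lyapunov_decrease V f u (a b gamma : R) :
  a <= b ->
  {within `[a, b], continuous (peval V \o u)} ->
  (forall t, a < t < b -> is_derive t 1 u (pevalv f (u t))) ->
  (forall t, a < t < b -> peval (lie_poly V f) (u t) <= - gamma) ->
  peval V (u b) + gamma * (b - a) <= peval V (u a).
Proof.
move=> ab cV du dV; move: ab; rewrite le_eqVlt => /predU1P[->|ab].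
  by rewrite subrr mulr0 addr0.
have [t tab|t + /= Vt] := @MVT _ (peval V \o u)
  (fun t => peval (lie_poly V f) (u t)) a b ab _ cV.
  by rewrite peval_lie; apply: is_derive_peval; apply: du; rewrite in_itv in tab.
rewrite in_itv => /= /dV lt; nra.
Qed.

(** The inequalities hold only inside the ball, so staying in it is proved by contradiction at the
    first exit time [T]: before [T] the function [V] decreases, hence [V (u T) < alpha * rho],
    whereas [V (u T) >= alpha * sqnorm (u T) >= alpha * rho]. *)
Lemma flow_bound V f u (D : set 'rV[R]_n) (a b alpha gamma rho : R) :
  0 < alpha ->
  (forall x, D x -> sqnorm x <= rho ->
     alpha * sqnorm x <= peval V x /\ peval (lie_poly V f) x <= - gamma) ->
  0 < gamma -> a <= b ->
  (forall p, {within `[a, b], continuous (peval p \o u)}) ->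
  (forall t, a < t < b -> is_derive t 1 u (pevalv f (u t))) ->
  (forall t, a <= t <= b -> D (u t)) ->
  sqnorm (u a) < rho -> peval V (u a) < alpha * rho ->
  sqnorm (u b) < rho /\ peval V (u b) + gamma * (b - a) <= peval V (u a).
Proof.
move=> al0 DV g0 ab cu du Du ua Va.
have small t : a <= t <= b -> sqnorm (u t) < rho.
  move=> /andP[at_ tb]; rewrite ltNge; apply/negP => rt.
  have sub s : s <= b -> `[a, s] `<=` `[a, b].
    by move=> sb; apply: subset_itvl; rewrite bnd_simp.
  have [||//|//|T [aT Tt rT Tlt]] := @first_exit (sqnorm \o u) a t rho.
  - exact: continuous_subspaceW (sub t tb) (cu _).
  - exact: ua.
  have Tb : T <= b := le_trans Tt tb.
  have cT p := continuous_subspaceW (sub T Tb) (cu p).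
  (* The lower bound on [V] is available at [T] only if [u T] is in the closed ball; this follows by
     left continuity from earlier times. *)
  have sT : sqnorm (u T) <= rho.
    have [_ _] := (continuous_within_itvP _ aT).1 (cT (sqnorm_poly R n)).
    move=> cvT; apply: (closed_cvg (fun y : R => y <= rho) _ _ _ cvT).
      exact: closed_le.
    near=> s; apply/ltW/Tlt; apply/andP; split; last by near: s; exact: nbhs_left_lt.
    by near: s; exact: nbhs_left_ge.
  have VT : peval V (u T) + gamma * (T - a) <= peval V (u a).
    apply: (@lyapunov_decrease V f) (ltW aT) (cT V) _ _ => s /andP[as_ sT'].
      by apply: du; rewrite as_ (lt_le_trans sT').
    apply: (DV _ _ _).2; last by rewrite ltW// Tlt// sT' ltW.
    by apply: Du; rewrite (ltW as_) (le_trans (ltW sT')).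
  have DT : D (u T) by apply: Du; rewrite (ltW aT) Tb.
  have aV := (DV _ DT sT).1.
  have : alpha * rho <= alpha * sqnorm (u T) by rewrite ler_pM2l//; exact: rT.
  have : 0 < gamma * (T - a) by rewrite mulr_gt0// subr_gt0.
  lra.
split; first by apply: small; rewrite ab lexx.
apply: (@lyapunov_decrease V f) => // t /andP[at_ tb].
have tab : a <= t <= b by rewrite !ltW.
exact: (DV _ (Du _ tab) (ltW (small _ tab))).2.
Unshelve. all: by end_near. Qed.

End Flow.

(** * Left limits of bounded flows *)

Section LeftLimit.
Context {R : realType} {n : nat}.

Lemma cvg_row (T : Type) (F : set_system T) (FF : Filter F)
    (u : T -> 'rV[R]_n) (l : 'rV[R]_n) :
  (forall i, u t 0 i @[t --> F] --> l 0 i) -> u t @[t --> F] --> l.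
Proof.
move=> ul; apply/cvgrPdist_le => e e0.
have : \forall t \near F, forall i, `|l 0 i - u t 0 i| <= e.
  by apply: filter_forall => i; by move: e e0; apply/cvgrPdist_le/ul.
apply: filterS => t le_e.
rewrite [leLHS]/Num.Def.normr/= mx_normrE bigmax_le ?(ltW e0)//= => -[k i] _.
by rewrite !mxE (ord1 k).
Qed.

(** A polynomial field is bounded on a ball, so a flow kept there has bounded velocity and cannot
    oscillate as time tends to [b]. This supplies the limit state required by [terminates]. *)
Lemma flow_left_lim (f : n.-tuple (mpoly.mpoly n R)) (u : R -> 'rV[R]_n)
    (a b rho : R) :
  a < b ->
  (forall t, a < t < b ->
     is_derive t 1 u (pevalv f (u t)) /\ sqnorm (u t) <= rho) ->
  exists x : 'rV[R]_n, u t @[t --> b^'-] --> x.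
Proof.
move=> ab du.
suff cu i : cvg (u t 0 i @[t --> b^'-]).
  exists (\row_i lim (u t 0 i @[t --> b^'-])); apply: cvg_row => i.
  by rewrite mxE; exact: cu.
have [M fM] := bounded_peval (tnth f i) rho.
have [N uN] := bounded_peval (mpoly.mpolyX R (mpoly.mnm1 i)) rho.
(* Adding M * s makes the coordinate monotone and keeps it bounded. *)
have dui t : a < t < b ->
    is_derive t 1 (fun s => u s 0 i + M * s) (pevalv f (u t) 0 i + M).
  move=> /du[[dut Du] _].
  have : is_derive t 1 (fun s => u s 0 i) (pevalv f (u t) 0 i).
    split; first exact: (derivable_mxP u t 1).1.
    by rewrite -Du derive_mx// mxE.
  have dM : is_derive t 1 (fun s : R => M * s) M.
    rewrite (_ : (fun s => _) = M \*: id)//; apply: is_derive_eq.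
    by rewrite /GRing.scale /= mulr1.
  by move=> dui; exact: (is_deriveD dui dM).
have ndh : {in `]a, b[ &, {homo (fun s => u s 0 i + M * s) : x y / x <= y}}.
  apply: ger0_derive1_le_oo => t; rewrite ?mem_setE in_itv/= => tab.
  - by case: (dui _ tab).
  - rewrite derive1E; have [_ ->] := dui _ tab.
    have := fM _ (du _ tab).2; rewrite ler_norml mxE => /andP[+ _]; lra.
  - by apply: differentiable_continuous; apply/derivable1_diffP; case: (dui _ tab).
(* [M] bounds an absolute value at the midpoint, hence is nonnegative; this allows [M * s <= M * b]
   below. *)
have M0 : 0 <= M.
  have mab : a < (a + b) / 2 < b by rewrite midf_lt//= midf_lt.
  exact: le_trans (fM _ (du _ mab).2).
suff : cvg ((u s 0 i + M * s) @[s --> b^'-]).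
  move=> ch; rewrite (_ : (fun t => u t 0 i) =
      (fun s => u s 0 i + M * s) \- (fun s => M * s)); last first.
    by apply/funext => s /=; rewrite addrK.
  apply: is_cvgB => //; apply: is_cvgMr; apply: cvgP.
  exact: cvg_at_left_filter (@cvg_id _ _).
apply: nondecreasing_at_left_is_cvgr; near=> x.
  move=> s t; rewrite !in_itv/= => /andP[xs sb] /andP[xt tb].
  have ax : a <= x by near: x; exact: nbhs_left_ge.
  by apply: ndh; rewrite in_itv/= ?(le_lt_trans ax) ?sb ?tb.
have ax : a <= x by near: x; exact: nbhs_left_ge.
exists (N + M * b) => _ [s + <-]; rewrite /= in_itv/= => /andP[xs sb].
have sab : a < s < b by rewrite (le_lt_trans ax xs) sb.
have := uN _ (du _ sab).2; rewrite pevalX ler_norml => /andP[_ us].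
by rewrite lerD// ler_wpM2l// ltW.
Unshelve. all: by end_near. Qed.

End LeftLimit.

(** * Mode sequences of cyclic systems and recurring contractions *)

(** Unique outgoing edges define a successor map, unique incoming edges make it injective, and
    connectedness gives it a single orbit. The modes are its iterates, so each is met within [#|Q|]
    steps. *)
Lemma cyclic_return (R : realType) (n : nat) (Q : finType)
    (H : hybrid_system R n Q) (q' : Q) (mode : nat -> Q) :
  cyclic_system H ->
  (forall i, (mode i, mode i.+1) \in edges H) ->
  exists2 k, (k < #|Q|)%N & mode k = q'.
Proof.
move=> [out inn conn] em.
have [out_edge outP] := choice out.
pose succ q := (out_edge q).2.
have succE e : e \in edges H -> succ e.1 = e.2.
  by move=> eH; rewrite /succ; have [_ /(_ e) ->] := outP e.1.
have succI : injective succ.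
  move=> q1 q2 e12; have [[e1H <-] _] := outP q1; have [[e2H <-] _] := outP q2.
  have [e [_ eu]] := inn (succ q1).
  by rewrite -(eu (out_edge q1))// -(eu (out_edge q2)).
have modeE k : mode k = iter k succ (mode 0%N).
  by elim: k => //= k <-; rewrite (succE _ (em k)).
(* Orbits of an injective map on a finite type are symmetric, so edges traversed backwards also stay
   in the orbit. *)
have c : fconnect succ (mode 0%N) q'.
  apply: connect_sub (conn (mode 0%N) q') => x y /= /orP[/succE /= <-|/succE /= <-].
    exact: fconnect1.
  by rewrite fconnect_sym//; exact: fconnect1.
exists (findex succ (mode 0%N) q'); last by rewrite modeE iter_findex.
by apply: leq_trans (findex_max c) _; rewrite max_card.
Qed.

Lemma within_continuous_peval {R : realType} {n : nat} (u : R -> 'rV[R]_n)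
    (a b : R) (p : mpoly.mpoly n R) :
  a < b -> (forall t, a < t < b -> derivable u t 1) ->
  u t @[t --> a^'+] --> u a -> u t @[t --> b^'-] --> u b ->
  {within `[a, b], continuous (peval p \o u)}.
Proof.
move=> ab du ua ub; apply/continuous_within_itvP => //; split.
- move=> t; rewrite in_itv/= => tab.
  apply: continuous_comp; last exact: continuous_peval.
  by apply: differentiable_continuous; apply/derivable1_diffP; exact: du.
- exact: cvg_peval ua.
- exact: cvg_peval ub.
Qed.

(** The sequence is nonincreasing and nonnegative, so it has a limit [l >= 0]; a contraction in
    every window of length [K] gives [l <= r' * l], which forces [l = 0]. *)
Lemma cvg0_recurring_contraction (R : realType) (v r : nat -> R) (r' : R) (K : nat) :
  (forall i, 0 <= v i) -> (forall i, v i.+1 <= r i * v i) ->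
  (forall i, 0 <= r i <= 1) -> r' < 1 ->
  (forall i, exists2 k, (k < K)%N & r (i + k)%N = r') ->
  v i @[i --> \oo] --> 0.
Proof.
move=> v0 vr r1 r'1 rK.
have vS i : v i.+1 <= v i.
  by have /andP[_ ri1] := r1 i; rewrite (le_trans (vr i))// ler_piMl.
have vD i k : v (i + k)%N <= v i.
  by elim: k => [|k IH]; rewrite ?addn0// addnS (le_trans (vS _)).
have vK i : v (i + K)%N <= r' * v i.
  have [k kK rk] := rK i.
  (* The window is cut at the contracting index: monotonicity handles the indices after [i + k.+1]
     and before [i + k], and the factor [r'] is gained in between. *)
  rewrite -(subnKC kK) addnA (le_trans (vD _ _))// addnS (le_trans (vr _))// rk.
  by have /andP[+ _] := r1 (i + k)%N; rewrite rk => r'0; rewrite ler_wpM2l.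
have cv : cvgn v.
  apply: nonincreasing_is_cvgn; first by apply/nonincreasing_seqP.
  by exists 0 => _ [i _ <-].
have l0 : 0 <= limn v by apply: limr_ge => //; exact: nearW.
have lK : limn v <= r' * limn v.
  have cK : v (i + K)%N @[i --> \oo] --> limn v by rewrite (cvg_shiftn K v).
  have cr : r' * v i @[i --> \oo] --> r' * limn v.
    by apply: cvgM => //; exact: cvg_cst.
  by apply: ler_cvg_to cK cr _; exact: nearW.
suff -> : 0 = limn v by [].
apply/eqP; rewrite eq_le l0 /=; nra.
Qed.

(** * Executions started in the trapping region *)

Section LyapunovExecution.
Context {R : realType} {n : nat} {Q : finType}.
Context {H : hybrid_system R n Q} {f : Q -> n.-tuple (mpoly.mpoly n R)}.
Context {V : Q -> mpoly.mpoly n R} {alpha gamma rho : R} {r : Q -> R}.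
Hypothesis fieldE : forall q x, dom H q x -> vfield H q x = pevalv (f q) x.
Hypotheses (alpha0 : 0 < alpha) (gamma0 : 0 < gamma).
Hypothesis r01 : forall q, 0 < r q <= 1.
Hypothesis lyap : forall q x, dom H q x -> sqnorm x <= rho ->
  alpha * sqnorm x <= peval (V q) x /\ peval (lie_poly (V q) (f q)) x <= - gamma.
Hypothesis lyap_jump : forall e x,
  e \in edges H -> guard H e x -> sqnorm x <= rho ->
  alpha * sqnorm (reset H e x) <= peval (V e.2) (reset H e x) /\
  peval (V e.2) (reset H e x) <= r e.1 * peval (V e.1) x.

(** The ball is a clause of its own because [V q] is controlled only inside it: far from the origin
    the sublevel set may contain unrelated points. *)
Definition trapping_region q : set 'rV[R]_n :=
  [set x | [/\ dom H q x, sqnorm x < rho & peval (V q) x < alpha * rho]].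

Lemma trapping_ge0 {q x} : trapping_region q x -> 0 <= peval (V q) x.
Proof.
move=> [Dx /ltW xr _]; apply: le_trans (lyap _ _ Dx xr).1.
exact: mulr_ge0 (ltW alpha0) (sqnorm_ge0 x).
Qed.

Context {q0 : Q} {x0 : 'rV[R]_n} {chi : execution R n Q}.
Hypothesis exe : is_execution H q0 x0 chi.
Hypothesis x0_region : trapping_region q0 x0.

(** [fine] sends an infinite time to 0, so [T i] is meaningful only where [tau chi i] is finite, in
    particular on [idx chi]. *)
Let T i : R := fine (tau chi i).
Let start i := traj chi i (T i).
Let final i := traj chi i (T i.+1).
Let region i := trapping_region (mode chi i).
Let value i x := peval (V (mode chi i)) x.

Lemma tauE {i} : idx chi i -> tau chi i = (T i)%:E.
Proof. by move=> /(exec_tau_fin exe)/fineK. Qed.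

(** Here [t] stays strictly before a right end that may be infinite: this is the form suited to a
    last interval, where no final state is given. *)
Lemma flow_region {i t} : idx chi i -> region i (start i) ->
  T i <= t -> (t%:E < tau chi i.+1)%E ->
  region i (traj chi i t) /\
  value i (traj chi i t) + gamma * (t - T i) <= value i (start i).
Proof.
move=> ii reg; have [Ds sr Vs] := reg; rewrite le_eqVlt => /predU1P[<- _|Tt tT].
  by rewrite subrr mulr0 addr0; split; [exact: reg|exact: lexx].
have flow s : T i < s <= t ->
    is_derive s 1 (traj chi i) (pevalv (f (mode chi i)) (traj chi i s)) /\
    dom H (mode chi i) (traj chi i s).
  move=> /andP[Ts st]; have [|ds _ Dx] := @exec_flow _ _ _ _ _ _ _ exe i s ii.
    by rewrite (tauE ii) lte_fin Ts (le_lt_trans _ tT) ?lee_fin.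
  by rewrite -fieldE.
have Dt : dom H (mode chi i) (traj chi i t) by apply: (flow t _).2; rewrite Tt lexx.
have ct : {for t, continuous (traj chi i)}.
  apply: differentiable_continuous; apply/derivable1_diffP.
  by have [|[]] := flow t; rewrite ?Tt ?lexx.
have [||||||] := @flow_bound R n (V (mode chi i)) (f (mode chi i)) (traj chi i)
    (dom H (mode chi i)) (T i) t alpha gamma rho alpha0 (lyap (mode chi i)) gamma0.
- exact: ltW.
- move=> p; apply: within_continuous_peval => //.
  + by move=> s /andP[Ts st]; have [|[]] := flow s; rewrite ?Ts ?ltW.
  + by apply: (exec_left exe) => //; rewrite (tauE ii) (lt_trans _ tT) ?lte_fin.
  + exact: cvg_at_left_filter.
- by move=> s /andP[Ts st]; have [] := flow s; rewrite ?Ts ?ltW.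
- move=> s /andP[]; rewrite le_eqVlt => /predU1P[<- //|Ts st].
  by apply: (flow s _).2; rewrite Ts.
- exact: sr.
- exact: Vs.
move=> tr Vt; split => //; split => //.
have : 0 < gamma * (t - T i) by rewrite mulr_gt0 ?subr_gt0.
by move: Vt Vs; rewrite /value /start; lra.
Qed.

Lemma final_region {i} : idx chi i -> idx chi i.+1 -> region i (start i) ->
  region i (final i) /\
  value i (final i) + gamma * (T i.+1 - T i) <= value i (start i).
Proof.
move=> ii iS reg; have [Ds sr Vs] := reg.
have : T i <= T i.+1 by rewrite -lee_fin -!tauE ?(exec_tau_le exe).
rewrite le_eqVlt => /predU1P[TT|TT].
  rewrite /final -TT.
  by rewrite subrr mulr0 addr0; split; [exact: reg|exact: lexx].
have tt : (tau chi i < tau chi i.+1)%E by rewrite !tauE.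
have flow s : T i < s < T i.+1 ->
    is_derive s 1 (traj chi i) (pevalv (f (mode chi i)) (traj chi i s)) /\
    dom H (mode chi i) (traj chi i s).
  move=> Ts; have [|ds _ Dx] := @exec_flow _ _ _ _ _ _ _ exe i s ii.
    by rewrite !tauE.
  by rewrite -fieldE.
(* The flow condition covers the open interval only; at the right end, membership in the domain
   comes from the guard. *)
have [eH ge _] := exec_jump exe ii iS.
have Dt : dom H (mode chi i) (final i) := guard_dom eH ge.
have [||||||] := @flow_bound R n (V (mode chi i)) (f (mode chi i)) (traj chi i)
    (dom H (mode chi i)) (T i) (T i.+1) alpha gamma rho alpha0
    (lyap (mode chi i)) gamma0.
- exact: ltW.
- move=> p; apply: within_continuous_peval => //.
  + by move=> s /flow[[]].
  + exact: (exec_left exe).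
  + exact: (exec_right exe).
- by move=> s /flow[].
- move=> s /andP[]; rewrite le_eqVlt => /predU1P[<- //|Ts].
  rewrite le_eqVlt => /predU1P[-> //|sT].
  by apply: (flow s _).2; rewrite Ts.
- exact: sr.
- exact: Vs.
move=> tr Vt; split => //; split => //.
have : 0 < gamma * (T i.+1 - T i) by rewrite mulr_gt0 ?subr_gt0.
by move: Vt Vs; rewrite /value /start; lra.
Qed.

(** The value of [V] does not grow at the jump, so it stays below [alpha * rho]; the lower bound at
    the reset point then brings that point back into the open ball. *)
Lemma jump_region {i} : idx chi i -> idx chi i.+1 -> region i (final i) ->
  region i.+1 (start i.+1) /\
  value i.+1 (start i.+1) <= r (mode chi i) * value i (final i).
Proof.
move=> ii iS reg; have [eH ge sE] := exec_jump exe ii iS.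
have V0 := trapping_ge0 reg; have [Df fr Vf] := reg.
have [aV rV] := lyap_jump _ _ eH ge (ltW fr).
have D' := reset_dom eH ge.
rewrite /region /value {1 2}/start sE; split => //.
have rVV : r (mode chi i) * value i (final i) <= value i (final i).
  by have /andP[_ r1] := r01 (mode chi i); rewrite ler_piMl.
have Vlt := le_lt_trans (le_trans rV rVV) Vf.
by split => //; rewrite -(ltr_pM2l alpha0) (le_lt_trans aV).
Qed.

(** [V] plus [gamma] times the elapsed time never increases: a flow spends [gamma] per unit of time,
    and a jump multiplies a nonnegative value by at most 1. *)
Lemma start_region {i} : idx chi i.+1 ->
  region i.+1 (start i.+1) /\
  value i.+1 (start i.+1) + gamma * T i.+1 <= peval (V q0) x0.
Proof.
elim: i => [_|i IH iS].
  rewrite /region /value /start /T (exec_tau1 exe) (exec_mode1 exe) /=.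
  by rewrite (exec_init exe) mulr0 addr0.
have ii := exec_idxS exe (ltn0Sn i) iS.
have [regs Vs] := IH ii.
have [regf Vf] := final_region ii iS regs.
have [regS VS] := jump_region ii iS regf.
split => //; have /andP[_ r1] := r01 (mode chi i.+1).
have : r (mode chi i.+1) * value i.+1 (final i.+1) <= value i.+1 (final i.+1).
  by rewrite ler_piMl// trapping_ge0.
lra.
Qed.

Hypothesis not_term : ~ terminates chi.

(** A last interval would have a finite right end, since [V] would otherwise become negative, and a
    limit state there, since the flow stays in the ball. The execution would then terminate. *)
Lemma no_blocking i : idx chi i.+1.
Proof.
elim: i => [|i IH]; first exact: exec_idx1 exe.
apply: contrapT => nS; apply: not_term; exists i.+1.
have [reg Vreg] := start_region IH.
have tau_le := exec_tau_le exe IH.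
have Tfin : tau chi i.+2 \is a fin_num.
  case E : (tau chi i.+2) => [x| |] //; last by move: tau_le; rewrite E tauE.
  (* By this time [V] would have lost its starting value plus 1, hence would be at most -1. *)
  set t := T i.+1 + (value i.+1 (start i.+1) + 1) / gamma.
  have V0 := trapping_ge0 reg.
  have Tt : T i.+1 <= t by rewrite lerDl divr_ge0 ?addr_ge0// ltW.
  have tlt : (t%:E < tau chi i.+2)%E by rewrite E ltry.
  have [/trapping_ge0 Vt] := flow_region IH reg Tt tlt.
  rewrite /t [_ + _ - _]addrAC subrr add0r mulrCA mulfV ?gt_eqF// mulr1.
  by move: Vt; rewrite /value /t; lra.
split => // tt.
  apply: (@flow_left_lim R n (f (mode chi i.+1)) _ (T i.+1) _ rho).
    by rewrite -lte_fin -tauE// fineK.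
  move=> t /andP[Tt tT]; have tlt : (t%:E < tau chi i.+2)%E.
    by rewrite -(fineK Tfin) lte_fin.
  have [[Dt /ltW tr _] _] := flow_region IH reg (ltW Tt) tlt.
  split => //; have [|dt _ _] := @exec_flow _ _ _ _ _ _ _ exe i.+1 t IH.
    by rewrite tauE// lte_fin Tt.
  by rewrite -fieldE.
Qed.

Lemma lyapunov_zeno : zeno chi.
Proof.
split.
  apply/seteqP; split => [[|i]//= /(exec_idx0 exe)//|[|i]//= _].
  exact: no_blocking.
have ndT : nondecreasing_seq (fun i => T i.+1).
  apply/nondecreasing_seqP => i; rewrite -lee_fin -!tauE; [|exact: no_blocking..].
  by apply: (exec_tau_le exe); exact: no_blocking.
have ubT : has_ubound (range (fun i => T i.+1)).
  exists (peval (V q0) x0 / gamma) => _ [i _ <-].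
  have [reg VT] := start_region (no_blocking i).
  rewrite ler_pdivlMr//; have := trapping_ge0 reg.
  by move: VT; rewrite /value; lra.
have cT := nondecreasing_is_cvgn ndT ubT.
exists (limn (fun i => T i.+1)).
(* [tau chi 0] is unconstrained, so the sequence is shifted to start at index 1. *)
rewrite -(cvg_shiftS (tau chi)).
apply: cvg_EFin; last exact: cT.
by apply: nearW => i; apply: (exec_tau_fin exe); exact: no_blocking.
Qed.

(** Sampling [V] just before each jump makes one step a jump, with factor [r] of the mode being
    left, followed by a flow that cannot increase [V]. The contracting mode recurs by cyclicity. *)
Lemma lyapunov_final_cvg0 : cyclic_system H -> (exists q, r q < 1) ->
  sqnorm (final i) @[i --> \oo] --> 0.
Proof.
move=> cyc [q rq].
have fin i : region i.+1 (final i.+1).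
  have := start_region (no_blocking i) => -[reg _].
  by have [] := final_region (no_blocking i) (no_blocking i.+1) reg.
have cV : value i.+1 (final i.+1) @[i --> \oo] --> 0.
  apply: (@cvg0_recurring_contraction R _ (fun i => r (mode chi i.+1)) (r q) #|Q|) => //.
  - by move=> i; exact: trapping_ge0 (fin i).
  - move=> i.
    have [reg Vs] := jump_region (no_blocking i) (no_blocking i.+1) (fin i).
    apply: le_trans Vs.
    have [_] := final_region (no_blocking i.+1) (no_blocking i.+2) reg.
    have : 0 <= gamma * (T i.+3 - T i.+2); last by lra.
    rewrite mulr_ge0 ?(ltW gamma0)// subr_ge0 -lee_fin -!tauE; try exact: no_blocking.
    by apply: (exec_tau_le exe); exact: no_blocking.
  - by move=> i; have /andP[/ltW -> ->] := r01 (mode chi i.+1).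
  - move=> i.
    have [j|k kQ kq] := @cyclic_return R n Q H q (fun j => mode chi (i + j).+1) cyc.
      rewrite addnS.
      by have [] := exec_jump exe (no_blocking (i + j)) (no_blocking (i + j).+1).
    by exists k => //; rewrite kq.
rewrite -(cvg_shiftS (fun i => sqnorm (final i))) /=.
apply: (@squeeze_cvgr _ _ _ _ (cst 0) (fun i => alpha^-1 * value i.+1 (final i.+1))).
- apply: nearW => i; rewrite sqnorm_ge0/= ler_pdivlMl//.
  by have [D /ltW l _] := fin i; exact: (lyap _ _ D l).1.
- exact: cvg_cst.
- by rewrite -(mulr0 alpha^-1); apply: cvgM => //; exact: cvg_cst.
Qed.

End LyapunovExecution.

(** * From sum-of-squares certificates to Zeno stability *)

Theorem theorem7 (R : realType) (n : nat) (Q : finType)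
  (H : hybrid_system R n Q) (P : poly_data R n Q)
  (z : Q -> 'rV[R]_n)
  (Kw : Q -> nat) (w : forall q : Q, 'I_(Kw q) -> mpoly.mpoly n R)
  (a c ii : forall q : Q, 'I_(Kw q) -> mpoly.mpoly n R)
  (b d j : forall q : Q, 'I_(numg P q) -> mpoly.mpoly n R)
  (m : forall e : Q * Q, 'I_(numh P e.1) -> mpoly.mpoly n R)
  (V : Q -> mpoly.mpoly n R) (m0 : Q * Q -> mpoly.mpoly n R)
  (alpha gamma : R) (r : Q -> R) :
  has_poly_data H P ->
  cyclic_system H ->
  zeno_equilibrium H z ->
  (forall q, within (dom H q) (nbhs (z q))
     [set x | dom H q x /\ forall k, 0 <= peval (w q k) x]) ->
  (forall q k, [/\ sos (a q k), sos (c q k) & sos (ii q k)]) ->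
  (forall q k, [/\ sos (b q k), sos (d q k) & sos (j q k)]) ->
  (forall e, e \in edges H -> forall l, sos (m e l)) ->
  0 < alpha -> 0 < gamma ->
  (forall q, 0 < r q <= 1) ->
  (exists q, r q < 1) ->
  (forall q, sos (V q - alpha *: sqnorm_poly R n
                  - \sum_(k < Kw q) a q k * w q k
                  - \sum_(k < numg P q) b q k * gpoly P q k)) ->
  (forall q, peval (V q) (z q) = 0) ->
  (forall q, sos (- lie_poly (V q) (fpoly P q) - mpoly.mpolyC n gamma
                  - \sum_(k < Kw q) c q k * w q k
                  - \sum_(k < numg P q) d q k * gpoly P q k)) ->
  (forall e, e \in edges H ->
     sos (r e.1 *: V e.1 - mpoly.comp_mpoly (phipoly P e) (V e.2)
          - m0 e * h0poly P e
          - \sum_(l < numh P e.1) m e l * hpoly P e l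
          - \sum_(k < Kw e.1) ii e.1 k * w e.1 k
          - \sum_(k < numg P e.1) j e.1 k * gpoly P e.1 k)) ->
  zeno_stable H z.
Proof.
move=> HP cyc [zD zG zF] Wz sw sg sm alpha0 gamma0 r01 rlt1 hV V0 hlie hjump.
pose W q := [set x | dom H q x /\ forall k, 0 <= peval (w q k) x].
have domE q x : dom H q x -> forall k, 0 <= peval (gpoly P q k) x.
  by rewrite (dom_poly HP).
(* On [W q] the multipliers and constraints are nonnegative, so each certificate becomes a pointwise
   inequality. *)
have comb_ge0 q x (s : forall q, 'I_(Kw q) -> mpoly.mpoly n R)
    (t : forall q, 'I_(numg P q) -> mpoly.mpoly n R) : W q x ->
    (forall k, sos (s q k)) -> (forall k, sos (t q k)) ->
    0 <= peval (\sum_(k < Kw q) s q k * w q k) x /\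
    0 <= peval (\sum_(k < numg P q) t q k * gpoly P q k) x.
  by move=> [Dx wx] ss st; split; apply: sos_comb_ge0 => //; exact: domE.
have V_lower q x : W q x -> alpha * sqnorm x <= peval (V q) x.
  move=> Wx; have [||p1 p2] := comb_ge0 q x a b Wx.
  - by move=> k; have [] := sw q k.
  - by move=> k; have [] := sg q k.
  have := sos_ge0 _ x (hV q); rewrite !pevalB pevalZ -/(sqnorm x).
  by move: p1 p2; lra.
have V_flow q x : W q x -> peval (lie_poly (V q) (fpoly P q)) x <= - gamma.
  move=> Wx; have [||p1 p2] := comb_ge0 q x c d Wx.
  - by move=> k; have [] := sw q k.
  - by move=> k; have [] := sg q k.
  have := sos_ge0 _ x (hlie q); rewrite !pevalB pevalN pevalC.
  by move: p1 p2; lra.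
have V_jump e x : e \in edges H -> guard H e x -> W e.1 x ->
    peval (V e.2) (reset H e x) <= r e.1 * peval (V e.1) x.
  move=> eH ge Wx; have [||p1 p2] := comb_ge0 e.1 x ii j Wx.
  - by move=> k; have [] := sw e.1 k.
  - by move=> k; have [] := sg e.1 k.
  move: (ge); rewrite (guard_poly HP eH) => -[h0 hl].
  have p3 := sos_comb_ge0 _ _ _ x (sm e eH) hl.
  have := sos_ge0 _ x (hjump e eH).
  (* The multiplier [m0 e] has arbitrary sign, but its term vanishes on the guard. *)
  rewrite !pevalB pevalZ peval_comp pevalM h0 mulr0 -(reset_poly HP eH ge).
  by move: p1 p2 p3; lra.
have Wzz q : W q (z q) by apply: (nbhs_singleton (Wz q)).
have z0 q : z q = 0.
  apply: sqnorm_le0; have := V_lower _ _ (Wzz q).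
  by rewrite V0 pmulr_rle0.
(* One radius serves all modes because [Q] is finite. *)
have [delta delta0 Wdelta] : exists2 delta, 0 < delta &
    forall x, sqnorm x <= delta -> forall q, dom H q x -> W q x.
  suff /nbhs0_sqnorm : \forall x \near (0 : 'rV[R]_n), forall q, dom H q x -> W q x.
    by [].
  apply: (@filter_forall _ Q (fun q x => dom H q x -> W q x) _ (nbhs_filter _)) => q.
  by rewrite -(z0 q); exact: Wz.
have small p (y : R) :
    peval p 0 < y -> \forall x \near (0 : 'rV[R]_n), peval p x < y.
  by move=> py; exact: (@continuous_peval R n p 0 [set t | t < y] (lt_nbhsl py)).
have [rho rho0 rhoP] : exists2 rho, 0 < rho & forall x, sqnorm x <= rho ->
    sqnorm x <= delta /\
    forall e, e \in edges H -> sqnorm (pevalv (phipoly P e) x) <= delta.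
  suff /nbhs0_sqnorm : \forall x \near (0 : 'rV[R]_n), sqnorm x <= delta /\
      forall e, e \in edges H -> sqnorm (pevalv (phipoly P e) x) <= delta.
    by [].
  apply: filterI.
    have : peval (sqnorm_poly R n) 0 < delta by rewrite -/(sqnorm _) sqnorm0.
    by move=> /small; apply: filterS => x /ltW.
  apply: (@filter_forall _ _ (fun e x => e \in edges H ->
    sqnorm (pevalv (phipoly P e) x) <= delta) _ (nbhs_filter _)) => e.
  have [eH|_] := boolP (e \in edges H); last first.
    exact: nearW.
  (* Since every [z q] is 0, the equilibrium condition says that resets fix the origin; continuity
     of the squared norm of the reset then yields the radius. *)
  have phi0 : pevalv (phipoly P e) 0 = 0.
    have [gz rz] := zG e eH; move: gz rz; rewrite !z0 => gz rz.
    by rewrite -(reset_poly HP eH gz).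
  have : peval (mpoly.comp_mpoly (phipoly P e) (sqnorm_poly R n)) 0 < delta.
    by rewrite peval_comp phi0 -/(sqnorm _) sqnorm0.
  by move=> /small; apply: filterS => x; rewrite peval_comp => /ltW.
have lyap q x : dom H q x -> sqnorm x <= rho ->
    alpha * sqnorm x <= peval (V q) x /\
    peval (lie_poly (V q) (fpoly P q)) x <= - gamma.
  move=> Dx /rhoP[xd _]; have Wx := Wdelta _ xd _ Dx.
  by split; [exact: V_lower|exact: V_flow].
have lyap_jump e x : e \in edges H -> guard H e x -> sqnorm x <= rho ->
    alpha * sqnorm (reset H e x) <= peval (V e.2) (reset H e x) /\
    peval (V e.2) (reset H e x) <= r e.1 * peval (V e.1) x.
  (* The image may leave the ball of [rho] but not that of [delta], where the lower bound on [V]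
     still holds. *)
  move=> eH ge /rhoP[xd /(_ _ eH) rd]; split.
    apply: V_lower; apply: Wdelta; last exact: reset_dom.
    by rewrite (reset_poly HP eH ge).
  by apply: V_jump => //; apply: Wdelta xd _ _; exact: guard_dom ge.
have fieldE := vfield_poly HP.
exists (@trapping_region R n Q H V alpha rho); split.
  move=> q; split=> [x []//|]; rewrite z0.
  have n1 : \forall x \near (0 : 'rV[R]_n), sqnorm x < rho.
    by apply: small; rewrite -/(sqnorm _) sqnorm0.
  have n2 : \forall x \near (0 : 'rV[R]_n), peval (V q) x < alpha * rho.
    by apply: small; rewrite -[X in peval _ X](z0 q) V0 mulr_gt0.
  by apply: filterS2 n1 n2 => x ? ? ?.
move=> q0 x0 chi x0r exe nt; split.
  exact: (lyapunov_zeno fieldE alpha0 gamma0 r01 lyap lyap_jump exe x0r nt).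
move=> eps eps0.
have := lyapunov_final_cvg0 fieldE alpha0 gamma0 r01 lyap lyap_jump exe x0r nt cyc rlt1.
(* The convergence concerns squared norms, hence the threshold [eps ^+ 2]. *)
move=> /cvgrPdist_le/(_ _ (exprn_gt0 2 eps0))[N _ hN]; exists N => i /ltnW Ni.
have := hN i Ni; rewrite /= sub0r normrN ger0_norm ?sqnorm_ge0// z0 subr0 => le_eps.
by rewrite /enorm -sqnormE -(ger0_norm (ltW eps0)) -sqrtr_sqr ler_wsqrtr.
Qed.
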